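(* Let $f,f^\nu:\mathbb{R}^m\times\mathbb{R}^n\to\overline{\mathbb{R}}$, $\nu\in\mathbb{N}$, be Rockafellians, where $f$ is a Rockafellian for $\phi:\mathbb{R}^n\to\overline{\mathbb{R}}$ that is strictly exact for $\phi$, supported by $y\in\mathbb{R}^m$. Suppose that $f^\nu$ epi-converges to $f$, $y^\nu\to y$, $\epsilon^\nu\to0$ (with $\epsilon^\nu\in(0,\infty)$), $\inf f<\infty$, and $(\bar u,\bar x)$ is a cluster point of a sequence $$\big\{(u^\nu,x^\nu)\in\epsilon^\nu\text{-}\operatorname{argmin}_{u,x} f^\nu_{y^\nu}(u,x),\ \nu\in\mathbb{N}\big\}.$$ Then $\bar x\in\operatorname{argmin}\phi$.
   Context: $\overline{\mathbb{R}}=[-\infty,\infty]$, $\mathbb{N}=\{1,2,\dots\}$. A function $f:\mathbb{R}^m\times\mathbb{R}^n\to\overline{\mathbb{R}}$ is a Rockafellian for $\phi:\mathbb{R}^n\to\overline{\mathbb{R}}$ when $f(0,x)=\phi(x)$ for all $x$. (Each $f^\nu$ is a Rockafellian for some $\phi^\nu:\mathbb{R}^n\to\overline{\mathbb{R}}$.) For $y\in\mathbb{R}^m$, $f^\nu_y(u,x)=f^\nu(u,x)-\langle y,u\rangle$. A Rockafellian $f$ for $\phi$ is exact, supported by $y\in\mathbb{R}^m$, if $\inf_x f(u,x)\ge\inf\phi+\langle y,u\rangle$ for all $u\in\mathbb{R}^m$; it is strictly exact, supported by $y$, if in addition the inequality holds strictly for all $u\ne0$. For $g:\mathbb{R}^d\to\overline{\mathbb{R}}$: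 $\operatorname{dom} g=\{x\mid g(x)<\infty\}$, $\operatorname{argmin} g=\{x^\star\in\operatorname{dom} g\mid g(x^\star)\le\inf g\}$, and for $\epsilon\in(0,\infty)$, $\epsilon\text{-}\operatorname{argmin} g=\{x^\star\in\operatorname{dom} g\mid g(x^\star)\le\inf g+\epsilon\}$. Epi-convergence: $g^\nu$ epi-converges to $g$ when (i) $\liminf g^\nu(x^\nu)\ge g(x)$ whenever $x^\nu\to x$, and (ii) for every $x$ there is $x^\nu\to x$ with $\limsup g^\nu(x^\nu)\le g(x)$. *)

(* Defs.v *)
From HB Require Import structures.
From mathcomp Require Import all_boot all_order all_algebra.
From mathcomp Require Import all_classical all_reals all_analysis.
Import Order.TTheory GRing.Theory Num.Theory.
Import numFieldNormedType.Exports.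

Set Implicit Arguments.
Unset Strict Implicit.
Unset Printing Implicit Defensive.

Local Open Scope classical_set_scope.
Local Open Scope ring_scope.
Local Open Scope ereal_scope.

Definition dot (R : realType) (d : nat) (a b : 'rV[R]_d) : R :=
  (\sum_(i < d) a ord0 i * b ord0 i)%R.

Definition infval (R : realType) (T : Type) (g : T -> \bar R) : \bar R :=
  ereal_inf (range g).

(* Membership in [dom g] is part of [argmin] and [eps_argmin], so both are
   empty when g is identically +oo, whereas -oo is an admissible minimum. *)
Definition dom (R : realType) (T : Type) (g : T -> \bar R) : set T :=
  [set x | g x < +oo].

Definition argmin (R : realType) (T : Type) (g : T -> \bar R) : set T :=
  [set x | dom g x /\ g x <= infval g].

Definition eps_argmin (R : realType) (T : Type) (eps : R) (g : T -> \bar R) :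
  set T := [set x | dom g x /\ g x <= infval g + eps%:E].

(* Sequences indexed by {1, 2, ...} are indexed by nat, entry k standing for
   nu = k + 1. *)
Definition epi_converges (R : realType) (T : topologicalType)
    (g_ : nat -> T -> \bar R) (g : T -> \bar R) : Prop :=
  (forall (x_ : nat -> T) (x : T), x_ @ \oo --> x ->
     g x <= limn_einf (fun k => g_ k (x_ k))) /\
  (forall x : T, exists2 x_ : nat -> T, x_ @ \oo --> x &
     limn_esup (fun k => g_ k (x_ k)) <= g x).

Definition rockafellian (R : realType) (m n : nat)
    (f : 'rV[R]_m * 'rV[R]_n -> \bar R) (phi : 'rV[R]_n -> \bar R) : Prop :=
  forall x, f (0%R, x) = phi x.

(* The subtrahend is finite, so no oo - oo convention intervenes. *)
Definition tilt (R : realType) (m n : nat)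
    (f : 'rV[R]_m * 'rV[R]_n -> \bar R) (y : 'rV[R]_m) :
    'rV[R]_m * 'rV[R]_n -> \bar R :=
  fun ux => f ux - (dot y ux.1)%:E.

Definition exact_supported (R : realType) (m n : nat)
    (f : 'rV[R]_m * 'rV[R]_n -> \bar R) (phi : 'rV[R]_n -> \bar R)
    (y : 'rV[R]_m) : Prop :=
  forall u : 'rV[R]_m,
    infval phi + (dot y u)%:E <= infval (fun x => f (u, x)).

Definition strictly_exact_supported (R : realType) (m n : nat)
    (f : 'rV[R]_m * 'rV[R]_n -> \bar R) (phi : 'rV[R]_n -> \bar R)
    (y : 'rV[R]_m) : Prop :=
  exact_supported f phi y /\
  forall u : 'rV[R]_m, u <> 0%R ->
    infval phi + (dot y u)%:E < infval (fun x => f (u, x)).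

(* Main.v *)
(* A cluster point c of near-minimizers of the tilted functions minimizes the
   tilted limit [tilt f y]: otherwise a recovery sequence for a better point w
   would, for infinitely many indices, beat the near-minimizers by more than
   their tolerance.  Since f(0, .) = phi, this gives
   f(ubar, xbar) - <y, ubar> <= inf phi, and strict exactness then leaves only
   ubar = 0, so that phi(xbar) <= inf phi. *)
Require Import Defs.
From mathcomp Require Import all_boot all_order all_algebra.
From mathcomp Require Import all_classical all_reals all_analysis.
From mathcomp Require Import lra.
Import Order.TTheory GRing.Theory Num.Theory.
Import numFieldNormedType.Exports.

Local Open Scope classical_set_scope.
Local Open Scope ring_scope.

(** The upper limit is an infimum of suprema over sets of the filter, so one of these suprema
    already lies below [l]. *)
Lemma limn_esup_near_lt (R : realType) (u : nat -> \bar R) (l : \bar R) :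
  (limn_esup u < l)%E -> \forall k \near \oo, (u k < l)%E.
Proof.
move=> /ereal_inf_lt[_ [V FV <-] Vl]; apply: filterS FV => k Vk.
by apply: le_lt_trans Vl; apply: ereal_sup_ubound; exists k.
Qed.

Lemma limn_einf_near_gt (R : realType) (u : nat -> \bar R) (l : \bar R) :
  (l < limn_einf u)%E -> \forall k \near \oo, (l < u k)%E.
Proof.
rewrite lteNr => /limn_esup_near_lt; apply: filterS => k.
by rewrite lteN2.
Qed.

Lemma ereal_lt_dense (R : realType) (a b : \bar R) :
  (a < b)%E -> exists r : R, (a < r%:E)%E /\ (r%:E < b)%E.
Proof.
case: a b => [a| |] [b| |] //=; rewrite ?ltry ?ltNyr // => ab.
- exists ((a + b) / 2); rewrite !lte_fin; rewrite lte_fin in ab; lra.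
- exists (a + 1); rewrite ltry lte_fin; lra.
- exists (b - 1); rewrite ltNyr lte_fin; lra.
- by exists 0; rewrite ltry ltNyr.
Qed.

(* The liminf half of epi-convergence only speaks about full sequences, so a
   convergent subsequence is filled up with the constant c. *)
Lemma cluster_seq_agree (R : realType) (V : normedModType R) (v : nat -> V)
    (c : V) :
  cluster (v @ \oo) c ->
  exists2 z : nat -> V, z @ \oo --> c &
    forall N : nat, exists2 k, (N <= k)%N & z k = v k.
Proof.
move=> vc.
(* Passing to the distances from [c] reduces the extraction of a subsequence to real sequences. *)
have dc : cluster ((fun k => `|c - v k|) @ \oo) 0.
  apply/cluster_eventuallyP => e N e0.
  have vN : (v @ \oo) (v @` [set k | (N <= k)%N]).
    by exists N => // k /= Nk; exists k.
  have [_ [[k Nk <-]]] := vc _ _ vN (nbhsx_ballx c e e0).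
  rewrite -ball_normE /= => /ltW ke.
  by exists k => //; rewrite sub0r normrN normr_id.
have [s s_incr s0] := (cluster_eventually_cvg _ _).1 dc.
have s_ge N : (N <= s N)%N.
  elim: N => // N /leq_ltn_trans; apply.
  by move/increasing_seqP: s_incr; apply.
exists (fun k => if k \in range s then v k else c); last first.
  by move=> N; exists (s N) => //; rewrite mem_set //; exists N.
apply/cvgrPdist_lt => e e0.
have /cvgrPdist_lt/(_ e e0)[N _ sN] := s0.
(* Off the range of [s] the distance to [c] is zero; an index [k = s j] with [k >= s N] has
   [j >= N], because [s] reflects the order. *)
exists (s N) => // k /= Nk.
case: ifPn => [/set_mem [j _ jk]|_]; last by rewrite subrr normr0.
have Nj : (N <= j)%N by rewrite -s_incr leEnat jk.
by have := sN j Nj; rewrite /= sub0r normrN normr_id jk.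
Qed.

Lemma cvg_dot (R : realType) (d : nat) (a_ b_ : nat -> 'rV[R]_d)
    (a b : 'rV[R]_d) :
  a_ @ \oo --> a -> b_ @ \oo --> b ->
  (fun k => dot (a_ k) (b_ k)) @ \oo --> dot a b.
Proof.
move=> ha hb; rewrite /dot.
apply: cvg_big => [|i _]; first exact: add_continuous.
have coord_cvg (c_ : nat -> 'rV[R]_d) (c : 'rV[R]_d) :
    c_ @ \oo --> c -> (fun k => c_ k ord0 i) @ \oo --> c ord0 i.
  move=> cc; apply: (cvg_trans _ (coord_continuous (i := ord0) (j := i) (x := c))).
  by apply: cvg_app cc.
by apply: cvgM; exact: coord_cvg.
Qed.

Lemma cluster_eps_argmin_tilt (R : realType) (m n : nat)
    (f : 'rV[R]_m * 'rV[R]_n -> \bar R)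
    (f_ : nat -> 'rV[R]_m * 'rV[R]_n -> \bar R)
    (y : 'rV[R]_m) (y_ : nat -> 'rV[R]_m) (eps_ : nat -> R)
    (v_ : nat -> 'rV[R]_m * 'rV[R]_n) (c : 'rV[R]_m * 'rV[R]_n) :
  epi_converges f_ f -> y_ @ \oo --> y -> eps_ @ \oo --> 0 ->
  (forall k, eps_argmin (eps_ k) (tilt (f_ k) (y_ k)) (v_ k)) ->
  cluster (v_ @ \oo) c ->
  forall w, (tilt f y c <= tilt f y w)%E.
Proof.
move=> [epi_inf epi_sup] y_cvg eps_cvg v_min /cluster_seq_agree[z zc zv] w.
rewrite leNgt; apply/negP.
(* The real levels [b1 < b2] between the two tilted values keep the estimates finite even when these
   values are infinite. *)
move=> /ereal_lt_dense[b1 [wb1 /ereal_lt_dense[b2 [b12 b2c]]]].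
rewrite lte_fin in b12.
move: wb1; rewrite /tilt lteBlDr // -EFinD => wb1.
move: b2c; rewrite /tilt lteBrDr // -EFinD => b2c.
have [w_ w_cvg w_sup] := epi_sup w.
have w_near := limn_esup_near_lt _ _ _ (le_lt_trans w_sup wb1).
have z_near := limn_einf_near_gt _ _ _ (lt_le_trans b2c (epi_inf _ _ zc)).
(* The gap [b2 - b1] is split in three: one [e] for the inner product at [w_ k], one for that at
   [z k], one for the tolerance [eps_ k]. *)
have [e e0 b2E] : exists2 e, 0 < e & b2 = b1 + 3 * e.
  by exists ((b2 - b1) / 3); lra.
have fst_cvg (s : nat -> 'rV[R]_m * 'rV[R]_n) (p : 'rV[R]_m * 'rV[R]_n) :
    s @ \oo --> p -> (fun k => (s k).1) @ \oo --> p.1.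
  case: p => p q sp.
  exact: (cvg_comp s fst sp cvg_fst).
have /cvgrPdist_lt/(_ _ e0) dw := cvg_dot _ _ _ _ _ _ y_cvg (fst_cvg _ _ w_cvg).
have /cvgrPdist_lt/(_ _ e0) dz := cvg_dot _ _ _ _ _ _ y_cvg (fst_cvg _ _ zc).
move/cvgrPdist_lt/(_ _ e0): eps_cvg => de.
have [N _ HN] : \forall k \near \oo,
    [/\ (f_ k (w_ k) < (b1 + dot y w.1)%:E)%E,
        ((b2 + dot y c.1)%:E < f_ k (z k))%E,
        `|dot y w.1 - dot (y_ k) (w_ k).1| < e,
        `|dot y c.1 - dot (y_ k) (z k).1| < e &
        `|0 - eps_ k| < e].
  by near=> k; split; near: k; assumption.
(* All the bounds hold from [N] on, so a single later index at which [z] is a true near-minimizer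
   yields the contradiction. *)
have [k Nk zvk] := zv N.
have [fw fz] := HN k Nk; rewrite !ltr_norml => /andP[w1 w2] /andP[z1 z2] /andP[e1 e2].
have [_] := v_min k; rewrite -zvk => zmin.
have : (tilt (f_ k) (y_ k) (z k) <= tilt (f_ k) (y_ k) (w_ k) + (eps_ k)%:E)%E.
  apply: le_trans zmin _; rewrite leeD2r //.
  by apply: ereal_inf_lbound; exists (w_ k).
apply/negP; rewrite -ltNge /tilt.
apply: (@lt_trans _ _ (b2 - e)%:E).
  rewrite -lteBrDr // -EFinB lteBlDr // -EFinD; apply: lt_trans fw _.
  by rewrite lte_fin; lra.
rewrite lteBrDr // -EFinD; apply: lt_trans _ fz.
by rewrite lte_fin; lra.
Unshelve. all: by end_near. Qed.

Theorem proposition2p4 (R : realType) (m n : nat)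
    (f : 'rV[R]_m * 'rV[R]_n -> \bar R)
    (f_ : nat -> 'rV[R]_m * 'rV[R]_n -> \bar R)
    (phi : 'rV[R]_n -> \bar R) (phi_ : nat -> 'rV[R]_n -> \bar R)
    (y : 'rV[R]_m) (y_ : nat -> 'rV[R]_m) (eps_ : nat -> R)
    (u_ : nat -> 'rV[R]_m) (x_ : nat -> 'rV[R]_n)
    (ubar : 'rV[R]_m) (xbar : 'rV[R]_n)
    (f_rock : rockafellian f phi)
    (f__rock : forall k, rockafellian (f_ k) (phi_ k))
    (f_exact : strictly_exact_supported f phi y)
    (f_epi : epi_converges f_ f)
    (y_cvg : y_ @ \oo --> y)
    (eps_gt0 : forall k, 0 < eps_ k)
    (eps_cvg : eps_ @ \oo --> 0)
    (f_inf : (infval f < +oo)%E)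
    (ux_min : forall k, eps_argmin (eps_ k) (tilt (f_ k) (y_ k)) (u_ k, x_ k))
    (ux_cluster : cluster ((fun k => (u_ k, x_ k)) @ \oo) (ubar, xbar)) :
  argmin phi xbar.
Proof.
have tmin := cluster_eps_argmin_tilt _ _ _ _ _ _ _ _ _ _ f_epi y_cvg eps_cvg ux_min ux_cluster.
have [f_ex f_strict] := f_exact.
have dot0 : dot y 0 = 0 :> R by rewrite /dot big1 // => i _; rewrite mxE mulr0.
(* This bound puts [xbar] in [dom phi] at the end. Exactness at the [u] of a point where [f] is
   below [+oo] bounds [infval phi] plus a real number. *)
have phi_fin : (infval phi < +oo)%E.
  have [_ [[u x] _ <-] fux] := ereal_inf_lt f_inf.
  have phiu : (infval phi + (dot y u)%:E < +oo)%E.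
    apply: le_lt_trans (f_ex u) _; apply: le_lt_trans fux.
    by apply: ereal_inf_lbound; exists x.
  by move: phiu; rewrite !ltey; case: (infval phi).
have tilt_le : (f (ubar, xbar) <= infval phi + (dot y ubar)%:E)%E.
  (* The competitors are the points [(0, x)], where the tilt vanishes and [f] equals [phi]. *)
  rewrite -leeBlDr //; apply: le_ereal_inf_tmp => _ [x _ <-].
  by have := tmin (0, x); rewrite /tilt /= dot0 f_rock sube0.
have ubar0 : ubar = 0.
  apply: contrapT => /f_strict; apply/negP; rewrite -leNgt.
  by apply: le_trans tilt_le; apply: ereal_inf_lbound; exists xbar.
move: tilt_le; rewrite ubar0 dot0 adde0 f_rock => phi_le.
by split=> //; exact: le_lt_trans phi_fin.
Qed.
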